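(* Let $G$ be a finite undirected bipartite graph (possibly with multiple edges) with nonempty vertex set $V$ and edge set $E$, and let $b\in\mathbb{R}^V$ be nonzero with all entries nonnegative. Let $H$ be a spanning subgraph of $G$. Then the following are all equivalent: (i) $H$ is a graph of $\mathcal{P}(G,b)$, i.e. $H\in\mathcal{G}(G,b)$; (ii) $H$ is the graph of a subset of $\mathcal{P}(G,b)$; (iii) $H$ is the graph of an element of $\mathcal{P}(G,b)$, or $H$ has no edges; (iv) $H$ is the graph of a face of $\mathcal{P}(G,b)$; (v) $H$ is a union of graphs of vertices of $\mathcal{P}(G,b)$; (vi) $H$ is the union of the graphs of all vertices of $\mathcal{P}(G,b)$ whose graph is contained in $H$; (vii) $H$ has no edges, or else: $\sum_{v\in V_1}b_v\ge\sum_{v\in V_3}b_v$ for all pairwise disjoint (possibly empty) sets $V_1,V_2,V_3$ such that $V=V_1\cup V_2\cup V_3$ and $H[V_2\cup V_3,V_3]=\emptyset$, with the inequality holding as an equality if and only if $H[V_1,V_1\cup V_2]=\emptyset$; (viii) $H$ has no edges, or else: $\sum_{v\in C}b_v\ge\sum_{v\in V\setminus C}b_v$ for each vertex cover $C$ of $H$, with the inequality holding as an equality if and only if $V\setminus C$ is also a vertex cover of $H$.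
   Context: $\delta_G(v)$ denotes the set of edges of $G$ incident with $v$. $\mathcal{P}(G,b)=\{x\in\mathbb{R}^E \mid x_e\ge 0 \text{ for each } e\in E,\ \sum_{e\in\delta_G(v)}x_e=b_v \text{ for each } v\in V\}$ (a polytope; empty when $E=\emptyset$, since $b\ne0$). The faces of a polytope include $\emptyset$ and the polytope itself. A spanning subgraph of $G$ is a subgraph with vertex set $V$. For $X\subset\mathcal{P}(G,b)$, the graph $\mathrm{gr}(X)$ of $X$ is the spanning subgraph of $G$ with edge set $\{e\in E\mid \text{there exists } x\in X\text{ with }x_e>0\}$, and the graph of an element $x$ is $\mathrm{gr}(x)=\mathrm{gr}(\{x\})$. $\mathcal{G}(G,b)=\{\mathrm{gr}(X)\mid X\subset\mathcal{P}(G,b)\}$, whose elements are called the graphs of $\mathcal{P}(G,b)$. Union and containment of spanning subgraphs of $G$ mean union and containment of their edge sets; an empty union is the spanning subgraph with no edges. For $U,W\subset V$, $H[U,W]$ is the set of all edges of $H$ whose endpoints are $u$ and $w$ for some $u\in U$ and $w\in W$. A vertex cover of $H$ is a subset of $V$ which contains an endpoint of every edge of $H$. *)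

(* Defs.v *)
From mathcomp Require Import all_boot all_order all_algebra.
From mathcomp Require Import boolp classical_sets reals.

Set Implicit Arguments.
Unset Strict Implicit.
Unset Printing Implicit Defensive.

Import Order.TTheory GRing.Theory Num.Theory.
Local Open Scope ring_scope.

(* Finite undirected graphs with vertex set [V] and edge set [E]. Distinct
   edges may have the same endpoints; an edge with one endpoint is a loop. *)
Record multigraph (V E : finType) := Multigraph {
  ends : E -> {set V};
  card_ends : forall e, (0 < #|ends e| <= 2)%N }.

(* A spanning subgraph of [G : multigraph V E] always has vertex set [V], so it
   is represented by its edge set, an element of [{set E}]. *)

Section Graphs.
Variables (V E : finType) (G : multigraph V E).

Definition bipartite : Prop :=
  exists A : {set V}, forall e, exists u w,
    [/\ u \in A, w \notin A & ends G e = [set u; w]%SET].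

Definition incident_edges (v : V) : {set E} := [set e | v \in ends G e]%SET.

(* H[U, W] *)
Definition edges_between (H : {set E}) (U W : {set V}) : {set E} :=
  [set e in H | [exists u in U, exists w in W, ends G e == [set u; w]]]%SET.

Definition vertex_cover (H : {set E}) (C : {set V}) : Prop :=
  forall e, e \in H -> exists2 v, v \in C & v \in ends G e.

End Graphs.

Section Polytopes.
Variables (R : realType) (E : finType).
Implicit Types P F : set {ffun E -> R}.

(* A face is cut out by a valid linear inequality c x <= d. Taking c = 0 with
   d = 0 or d = 1 shows that [P] itself and the empty set are faces. *)
Definition face P F : Prop :=
  exists (c : {ffun E -> R}) (d : R),
    (forall x, P x -> \sum_e c e * x e <= d) /\
    F = [set x | P x /\ \sum_e c e * x e = d]%classic.

(* Vertices are the zero-dimensional faces. *)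
Definition vertex P (x : {ffun E -> R}) : Prop := face P [set x]%classic.

End Polytopes.

Section GraphsOfPolytope.
Variables (R : realType) (V E : finType) (G : multigraph V E).
Variable b : {ffun V -> R}.

Definition polytope : set {ffun E -> R} :=
  [set x | (forall e, 0 <= x e) /\
           (forall v, \sum_(e in incident_edges G v) x e = b v)]%classic.

(* A spanning subgraph depends only on its edges, so neither [V] nor [G] is
   needed to form the graph of a set of vectors indexed by [E]. *)
Definition gr (X : set {ffun E -> R}) : {set E} :=
  [set e | `[< exists2 x, X x & 0 < x e >]]%SET.

Definition gr1 (x : {ffun E -> R}) : {set E} := gr [set x]%classic.

Definition graphs_of_polytope : set {set E} :=
  [set gr X | X in [set X | X `<=` polytope]]%classic.

Definition vertex_graphs : {set {set E}} :=
  [set K | `[< exists2 x, vertex polytope x & K = gr1 x >]]%SET.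

End GraphsOfPolytope.

(* Main.v *)
Require Import Defs.
From mathcomp Require Import all_boot all_order all_algebra.
From mathcomp Require Import boolp classical_sets reals.
From mathcomp Require Import ring lra.

(* Averaging turns any nonempty graph of the polytope [P] into the graph of a
   single point, and a point of minimal support among those positive on a given
   edge is a vertex, because it is the only point of [P] on its support.
   Weighing the vertices by +1, 0, -1 and counting doubly over the edges gives
   the separation condition, of which the vertex cover condition is the case
   [V2 = set0].
   Conversely, subtracting a small multiple of the [H]-degrees from [b] keeps
   the cover inequalities, because they are strict where the degrees count;
   a solution supported in [H] for the perturbed vector, plus that multiple of
   the indicator of [H], is then a point of [P] with graph [H]. *)

Set Implicit Arguments.
Unset Strict Implicit.
Unset Printing Implicit Defensive.

Import Order.TTheory GRing.Theory Num.Theory.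
Local Open Scope ring_scope.

(** * Supports, faces and vertices of the polytope *)

Section Supports.
Variables (R : realType) (V E : finType) (G : multigraph V E).
Variable b : {ffun V -> R}.
Implicit Types (x y z : {ffun E -> R}) (X : set {ffun E -> R}) (K : {set E}).

Local Notation P := (polytope G b).

Lemma mem_gr1 x e : (e \in gr1 x) = (0 < x e).
Proof.
rewrite inE; apply/asboolP/idP => [[y ->]|xe] //.
by exists x.
Qed.

Lemma gr1_eq0 x e : P x -> e \notin gr1 x -> x e = 0.
Proof.
move=> [x0 _]; rewrite mem_gr1 -leNgt => xe.
by apply/eqP; rewrite eq_le xe x0.
Qed.

Lemma gr1_sub_gr X x : X x -> gr1 x \subset gr X.
Proof.
move=> Xx; apply/fintype.subsetP => e; rewrite mem_gr1 => xe.
by rewrite inE; apply/asboolP; exists x.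
Qed.

Lemma mem_incident_edges v e : (e \in incident_edges G v) = (v \in ends G e).
Proof. by rewrite inE. Qed.

Lemma double_count x (y : V -> R) :
  (forall v, \sum_(e in incident_edges G v) x e = b v) ->
  \sum_v y v * b v = \sum_e x e * \sum_(v in ends G e) y v.
Proof.
move=> xb.
under eq_bigr do rewrite -xb mulr_sumr.
rewrite (exchange_big_dep predT) //=; apply: eq_bigr => e _.
rewrite mulr_sumr; apply: eq_big => [v|v _]; last by rewrite mulrC.
by rewrite mem_incident_edges.
Qed.

(** Coordinates are nonnegative, so minus the sum of those outside [K] is at most 0, with equality
    exactly when they all vanish. *)
Lemma support_face K : face P [set x | P x /\ gr1 x \subset K]%classic.
Proof.
pose c : {ffun E -> R} := [ffun e => - (e \notin K)%:R].
have cxE x : \sum_e c e * x e = - \sum_(e | e \notin K) x e.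
  rewrite -sumrN [RHS]big_mkcond /=; apply: eq_bigr => e _.
  by rewrite ffunE; case: (e \in K); rewrite /= ?oppr0 ?mul0r ?mulN1r.
exists c, 0; split=> [x [x0 _]|].
  by rewrite cxE oppr_le0 sumr_ge0.
apply/seteqP; split=> x [Px] /= => [/fintype.subsetP xK|].
  split=> //; rewrite cxE big1 ?oppr0 // => e eK.
  by apply: gr1_eq0 => //; apply: contra eK => /xK.
rewrite cxE => /eqP; rewrite oppr_eq0 => /eqP xK0; split=> //.
apply/fintype.subsetP => e; rewrite mem_gr1 => xe.
apply: contraTT xe => eK; case: (Px) => x0 _.
by rewrite (psumr_eq0P _ xK0) ?ltxx.
Qed.

Lemma unique_support_vertex x :
  P x -> (forall y, P y -> gr1 y \subset gr1 x -> y = x) -> vertex P x.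
Proof.
move=> Px ux; rewrite /vertex.
suff -> : [set x]%classic = [set y | P y /\ gr1 y \subset gr1 x]%classic.
  exact: support_face.
apply/seteqP; split=> y /= => [->|[Py yx]]; [by split|exact: ux].
Qed.

(** A ratio test: [t] is the largest step along [z] that keeps all coordinates nonnegative, and an
    edge attaining it leaves the support. *)
Lemma shrink_support x z :
    P x -> (forall v, \sum_(e in incident_edges G v) z e = 0) ->
    (forall e, e \notin gr1 x -> z e = 0) -> (exists e, z e < 0) ->
  exists t y, [/\ 0 < t, y = [ffun e => x e + t * z e], P y & gr1 y \proper gr1 x].
Proof.
move=> Px zv zx [e0 ze0]; pose r e := x e / - z e.
case: (arg_minP r (i0 := e0) (P := fun e => z e < 0) ze0) => e1 ze1 rmin.
have e1x : e1 \in gr1 x.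
  by apply: contraTT ze1 => /zx ->; rewrite ltxx.
have x0 := Px.1; have t0 : 0 < r e1.
  by rewrite divr_gt0 ?oppr_gt0 -?mem_gr1.
pose y := [ffun e => x e + r e1 * z e].
exists (r e1), y; split=> //.
  split=> [e|v].
    rewrite ffunE; case: (ltP (z e) 0) => ze.
      have := rmin e ze; rewrite /r ler_pdivlMr ?oppr_gt0 // => h.
      by move: h; rewrite mulrN; lra.
    by rewrite addr_ge0 // mulr_ge0 // ltW.
  under eq_bigr do rewrite ffunE.
  by rewrite big_split /= -mulr_sumr zv mulr0 addr0 Px.2.
apply/properP; split.
  apply/fintype.subsetP => e; apply: contraTT => ex.
  by rewrite mem_gr1 ffunE zx // (gr1_eq0 Px ex) mulr0 addr0 ltxx.
exists e1 => //; rewrite mem_gr1 ffunE /r invrN mulrN mulNr mulfVK ?subrr ?ltxx //.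
by rewrite lt_eqF.
Qed.

(* Moving from [x] along the difference with another point of the polytope
   supported in [gr1 x] until a coordinate vanishes shrinks the support; the
   sign of the direction is chosen so that the coordinate [e] does not
   decrease. *)
Lemma vertex_through_edge x e : P x -> e \in gr1 x ->
  exists2 y, vertex P y & (gr1 y \subset gr1 x) && (e \in gr1 y).
Proof.
have [n] := ubnP #|gr1 x|; elim: n x => // n IHn x; rewrite ltnS => xn Px ex.
case: (pselect (forall y, P y -> gr1 y \subset gr1 x -> y = x)) => [ux|].
  by exists x; [exact: unique_support_vertex|rewrite subxx].
move=> /existsNP[y /not_implyP[Py /not_implyP[/fintype.subsetP yx /eqP ynx]]].
have shrink z : (forall v, \sum_(e in incident_edges G v) z e = 0) ->
    (forall e, e \notin gr1 x -> z e = 0) -> (exists e, z e != 0) -> 0 <= z e ->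
    exists2 y, vertex P y & (gr1 y \subset gr1 x) && (e \in gr1 y).
  move=> zv zx [f zf] ze.
  have [g zg] : exists g, z g < 0.
    case: (ltgtP (z f) 0) => [zf0|zf0|zf0]; first by exists f.
      (* Were no coordinate negative, the sum of [z] at an endpoint [v] of [f] would be positive,
         against [zv]. *)
      have /card_gt0P[v vf] : (0 < #|ends G f|)%N.
        by case/andP: (card_ends G f).
      apply: contrapT => /forallNP ng.
      move: zf0; have := zv v; rewrite (finset.big_setD1 f) ?mem_incident_edges //=.
      have : 0 <= \sum_(e in incident_edges G v :\ f) z e.
        by apply: sumr_ge0 => g _; rewrite leNgt; apply/negP/ng.
      lra.
    by rewrite zf0 eqxx in zf.
  have [t [w [t0 wE Pw wx]]] := shrink_support Px zv zx (ex_intro _ g zg).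
  have we : e \in gr1 w.
    by rewrite mem_gr1 wE ffunE ltr_wpDr ?mulr_ge0 ?(ltW t0) // -mem_gr1.
  have [u uv /andP[uw ue]] := IHn w (leq_trans (proper_card wx) xn) Pw we.
  by exists u => //; rewrite ue (fintype.subset_trans uw (proper_sub wx)).
pose z := [ffun e => y e - x e].
have zv v : \sum_(e in incident_edges G v) z e = 0.
  under eq_bigr do rewrite ffunE.
  by rewrite big_split /= sumrN Px.2 Py.2 subrr.
have zx f : f \notin gr1 x -> z f = 0.
  move=> fx; rewrite ffunE (gr1_eq0 Px fx) (gr1_eq0 Py) ?subrr //.
  by apply: contra fx => /yx.
have zn0 : exists f, z f != 0.
  apply: contrapT => /forallNP z0; move: ynx => /eqP; apply; apply/ffunP => f.
  by have /negP/negPn := z0 f; rewrite ffunE subr_eq0 => /eqP.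
case: (leP 0 (z e)) => ze; first exact: (shrink z).
apply: (shrink [ffun f => - z f]) => [v|f fx||].
- by under eq_bigr do rewrite ffunE; rewrite sumrN zv oppr0.
- by rewrite ffunE zx ?oppr0.
- by have [f zf] := zn0; exists f; rewrite ffunE oppr_eq0.
- by rewrite ffunE oppr_ge0 ltW.
Qed.

(** Pick for each edge of [gr X] a point of [X] positive there. The mean of these points stays in
    the polytope by convexity, and nonnegativity rules out cancellation. *)
Lemma gr_average X : (X `<=` P)%classic -> gr X != finset.set0 ->
  exists2 x, P x & gr X = gr1 x.
Proof.
move=> XP grX0; pose k : R := #|gr X|%:R.
have k0 : 0 < k by rewrite ltr0n card_gt0.
have /choice[w wP] : forall e, exists x, e \in gr X -> X x /\ 0 < x e.
  (* Outside [gr X] the point 0 is a dummy: the mean runs over [gr X] only. *)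
  move=> e; case: (boolP (e \in gr X)) => [|_]; last by exists 0.
  by rewrite inE => /asboolP[x Xx xe]; exists x.
pose x : {ffun E -> R} := [ffun e => k^-1 * \sum_(f in gr X) w f e].
have w0 f e : f \in gr X -> 0 <= w f e by move=> /wP[/XP[]].
exists x.
  split=> [e|v].
    by rewrite ffunE mulr_ge0 ?invr_ge0 ?(ltW k0) // sumr_ge0 // => f /w0.
  under eq_bigr do rewrite ffunE.
  rewrite -mulr_sumr exchange_big /= (eq_bigr (fun=> b v)).
    by rewrite sumr_const -[b v *+ _]mulr_natl mulKf // gt_eqF.
  by move=> f /wP[/XP[_ ->]].
apply/setP => e; rewrite mem_gr1 ffunE pmulr_rgt0 ?invr_gt0 //.
apply/idP/idP => [eX|].
  rewrite (bigD1 e) //= ltr_wpDr ?(wP e eX).2 // sumr_ge0 // => f /andP[fX _].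
  exact: w0.
move=> s0; have /psumr_neq0P : \sum_(f in gr X) w f e <> 0.
  by move=> h; rewrite h ltxx in s0.
case=> [f /w0 //|f /andP[fX fe]].
by apply: (fintype.subsetP (gr1_sub_gr (wP f fX).1)); rewrite mem_gr1.
Qed.

End Supports.

(** * Covers and separations along the bipartition *)

Section Covers.
Variables (R : realType) (V E : finType) (G : multigraph V E) (A : {set V}).
Hypothesis GA : forall e, exists u w,
  [/\ u \in A, w \notin A & ends G e = [set u; w]%SET].
Implicit Types (K : {set E}) (C D : {set V}) (b : {ffun V -> R}).

Lemma sum_ends e u w (y : V -> R) : u \in A -> w \notin A ->
  ends G e = [set u; w]%SET -> \sum_(v in ends G e) y v = y u + y w.
Proof.
move=> uA wA ->; rewrite finset.big_setU1 ?finset.big_set1 //.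
by rewrite finset.in_set1; apply: contraNneq wA => <-.
Qed.

Lemma mem_edges_between K (U W : {set V}) e u w :
  ends G e = [set u; w]%SET ->
  (e \in edges_between G K U W) =
  (e \in K) && ((u \in U) && (w \in W) || (w \in U) && (u \in W)).
Proof.
move=> euw; rewrite finset.inE; congr (_ && _); apply/existsP/orP.
  case=> u' /andP[u'U /existsP[w' /andP[w'W /eqP e']]].
  have : u \in [set u'; w']%SET by rewrite -e' euw !finset.inE eqxx.
  have : w \in [set u'; w']%SET by rewrite -e' euw !finset.inE eqxx orbT.
  have : u' \in [set u; w]%SET by rewrite -euw e' !finset.inE eqxx.
  have : w' \in [set u; w]%SET by rewrite -euw e' !finset.inE eqxx orbT.
  rewrite !finset.inE.
  move=> /orP[]/eqP ? /orP[]/eqP ? /orP[]/eqP ? /orP[]/eqP ?; subst;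
    rewrite ?u'U ?w'W; by [left|right].
case=> /andP[uU wW].
  by exists u; rewrite uU; apply/existsP; exists w; rewrite wW euw eqxx.
by exists w; rewrite uU; apply/existsP; exists u; rewrite wW euw finset.setUC eqxx.
Qed.

(** Naming the endpoint in [A] and the one outside turns emptiness into a Boolean condition, settled
    later by case analysis. *)
Lemma edges_between_eq0 K (U W : {set V}) :
  edges_between G K U W = finset.set0 <->
  forall e u w, e \in K -> u \in A -> w \notin A -> ends G e = [set u; w]%SET ->
    ~~ ((u \in U) && (w \in W) || (w \in U) && (u \in W)).
Proof.
split=> [K0 e u w eK _ _ euw|K0].
  by move: (finset.in_set0 e); rewrite -K0 (mem_edges_between _ _ _ euw) eK => /= ->.
apply/setP => e; have [u [w [uA wA euw]]] := GA e.
rewrite finset.in_set0 (mem_edges_between _ _ _ euw).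
by case: (boolP (e \in K)) => //= eK; apply/negbTE/(K0 e).
Qed.

Lemma vertex_coverE K C :
  vertex_cover G K C <->
  forall e u w, e \in K -> u \in A -> w \notin A -> ends G e = [set u; w]%SET ->
    (u \in C) || (w \in C).
Proof.
split=> [KC e u w /KC[v vC vE] _ _ euw|KC e eK].
  by move: vE; rewrite euw !finset.inE => /orP[]/eqP <-; rewrite vC ?orbT.
have [u [w [uA wA euw]]] := GA e.
by case/orP: (KC e u w eK uA wA euw) => ?; [exists u|exists w];
  rewrite // euw !finset.inE eqxx ?orbT.
Qed.

Definition cover_sign C (v : V) : R := if v \in C then 1 else -1.

(** A single signed sum over all vertices, rather than a difference of two sums, lets uncrossing and
    perturbation be checked vertex by vertex. *)
Definition excess b C : R := \sum_v cover_sign C v * b v.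

Lemma excessE b C : excess b C = \sum_(v in C) b v - \sum_(v in ~: C) b v.
Proof.
rewrite /excess (bigID [in C]) /= -sumrN; congr (_ + _).
  by apply: eq_bigr => v vC; rewrite /cover_sign vC mul1r.
apply: eq_big => [v|v]; first by rewrite finset.in_setC.
by rewrite /cover_sign => /negbTE ->; rewrite mulN1r.
Qed.

Lemma excess_setC b C : excess b (~: C) = - excess b C.
Proof. by rewrite !excessE finset.setCK opprB. Qed.

(** Adding the excesses of the full set and of the singleton of [v] leaves twice [b v]. *)
Lemma excess_eq0 b : (forall C, excess b C = 0) -> forall v, b v = 0.
Proof.
move=> b0 v; have := b0 [set v]%SET; have := b0 finset.setT.
rewrite !excessE finset.setCT finset.big_set0 finset.big_set1 subr0 (bigD1 v) //=.
rewrite (eq_bigl (mem (~: [set v]%SET))) => [|u]; last by rewrite !finset.inE.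
rewrite /=; lra.
Qed.

(** Each vertex lies in as many of the new sets as of [C] and [D]. Intersection and union trade
    places across [A] so that an edge covered by both [C] and [D] is covered by both new sets. *)
Lemma excess_uncross b C D :
  excess b C + excess b D =
  excess b (C :&: D :&: A :|: (C :|: D) :\: A) +
  excess b ((C :|: D) :&: A :|: C :&: D :\: A).
Proof.
rewrite /excess -!big_split /=; apply: eq_bigr => v _; rewrite -!mulrDl.
congr (_ * _); rewrite /cover_sign !finset.inE.
by case: (v \in C); case: (v \in D); case: (v \in A); rewrite //= addrC.
Qed.

Lemma excess_sub_edge b (t : R) e C :
  excess [ffun v => b v - t * (v \in ends G e)%:R] C =
  excess b C - t * \sum_(v in ends G e) cover_sign C v.
Proof.
rewrite [\sum_(v in ends G e) _]big_mkcond mulr_sumr -sumrN -big_split.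
apply: eq_bigr => v _; rewrite ffunE mulrBr /=; congr (_ - _).
by case: (v \in ends G e); rewrite ?mulr1 ?mulr0 // mulrC.
Qed.

(* Eliminate an edge [e = uw]: assigning it the weight [t] keeps the hypothesis
   for [K :\ e] provided [-excess D <= 2t <= excess C] for all covers [C] of [K]
   containing [u] and [w] and all covers [D] of [K :\ e] avoiding both. Such a
   [t] exists since the two sets obtained by uncrossing [C] and [D] along the
   bipartition are covers of [K]. *)
Lemma cover_feasible K b :
  (forall C, vertex_cover G K C -> 0 <= excess b C) ->
  exists2 x, polytope G b x & forall e, e \notin K -> x e = 0.
Proof.
have [n] := ubnP #|K|; elim: n K b => // n IHn K b; rewrite ltnS => Kn bK.
have [K0|[e eK]] := set_0Vmem K.
  (* Without edges every set is a cover, so [C] and its complement both have nonnegative excess;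
     these are opposite, hence zero. *)
  have KC C : vertex_cover G K C by move=> e; rewrite K0 finset.in_set0.
  have b0 : forall v, b v = 0.
    apply: excess_eq0 => C; apply/eqP.
    by rewrite eq_le bK // andbT -oppr_ge0 -excess_setC bK.
  exists [ffun=> 0]; last by move=> e; rewrite ffunE.
  split=> [e|v]; first by rewrite ffunE.
  by rewrite b0 big1 // => e _; rewrite ffunE.
have [u [w [uA wA euw]]] := GA e.
pose avoid D := [&& `[< vertex_cover G (K :\ e) D >], u \notin D & w \notin D].
(* The least admissible weight; the default 0 keeps it nonnegative. *)
pose t := \big[Num.max/0]_(D | avoid D) (- excess b D / 2).
have t0 : 0 <= t by exact: bigmax_ge_id.
have tD D : avoid D -> - excess b D / 2 <= t by exact: le_bigmax_cond.
have tC C : vertex_cover G K C -> u \in C -> w \in C -> t <= excess b C / 2.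
  move=> KC uC wC; apply: bigmax_le => [|D /and3P[/asboolP KD uD wD]].
    by rewrite divr_ge0 ?bK.
  suff : 0 <= excess b C + excess b D by lra.
  move/vertex_coverE: KC => KC; move/vertex_coverE: KD => KD.
  (* [D] can miss only [e], which [C] then repairs: the first uncrossed set contains [w], the second
     contains [u]. *)
  have KD' f p q : f \in K -> p \in A -> q \notin A -> ends G f = [set p; q]%SET ->
      f = e \/ (p \in D) || (q \in D).
    move=> fK pA qA fpq; have [->|fe] := eqVneq f e; [by left|right].
    by apply: KD fpq; rewrite // !finset.inE fe.
  rewrite excess_uncross addr_ge0 // bK //; apply/vertex_coverE => f p q fK pA qA fpq;
    have := KC f p q fK pA qA fpq; have := KD' f p q fK pA qA fpq;
    rewrite !finset.inE pA (negbTE qA) /= !andbT ?andbF ?orbF /=.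
    case=> [fe _|]; last by case: (p \in C); case: (p \in D); case: (q \in C); case: (q \in D).
    have : w \in [set p; q]%SET by rewrite -fpq fe euw !finset.inE eqxx orbT.
    rewrite !finset.inE => /orP[]/eqP wE; last by rewrite -wE wC orbT.
    by rewrite wE pA in wA.
  case=> [fe _|]; last by case: (p \in C); case: (p \in D); case: (q \in C); case: (q \in D).
  have : u \in [set p; q]%SET by rewrite -fpq fe euw !finset.inE eqxx.
  rewrite !finset.inE => /orP[]/eqP uE; first by rewrite -uE uC.
  by rewrite -uE uA in qA.
pose b' := [ffun v => b v - t * (v \in ends G e)%:R].
have [|C KC|x [x0 xb] xK] := IHn (K :\ e)%SET b'.
- by move: Kn; rewrite (cardsD1 e) eK.
- rewrite excess_sub_edge (sum_ends _ uA wA euw) /cover_sign.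
  have KeC : (u \in C) || (w \in C) -> vertex_cover G K C.
    move=> uwC f fK; have [->|fe] := eqVneq f e; last by apply: KC; rewrite !finset.inE fe.
    by case/orP: uwC => ?; [exists u|exists w]; rewrite // euw !finset.inE eqxx ?orbT.
  (* The excess drops by [2t] if both endpoints are in [C], is unchanged if exactly one is, and
     rises by [2t] if none is. *)
  case: (boolP (u \in C)) KeC => uC; case: (boolP (w \in C)) => wC KeC.
  + by have := tC C (KeC _) uC wC; move=> /(_ isT); lra.
  + by have := bK C (KeC _); move=> /(_ isT); lra.
  + by have := bK C (KeC _); move=> /(_ isT); lra.
  + have := tD C; rewrite /avoid uC wC !andbT => /(_ (asboolT KC)); lra.
exists [ffun f => x f + t * (f == e)%:R]; last first.
  move=> f fK; rewrite ffunE xK ?finset.inE ?negb_and ?fK ?orbT //.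
  by rewrite (_ : f == e = false) ?mulr0 ?addr0 //; apply: contraNF fK => /eqP ->.
split=> [f|v]; first by rewrite ffunE addr_ge0 ?mulr_ge0.
under eq_bigr do rewrite ffunE.
rewrite big_split /= xb ffunE -mulr_sumr -addrA [X in _ + X](_ : _ = 0) ?addr0 //.
rewrite -mulrN -mulrDr [X in _ * X](_ : _ = 0) ?mulr0 //.
rewrite big_mkcond (bigD1 e) //= mem_incident_edges eqxx big1 => [|f /negbTE ->].
  by case: (v \in _); rewrite /= addr0 addNr.
by rewrite if_same.
Qed.

Lemma cover_graph K b :
    (forall C, vertex_cover G K C ->
       0 <= excess b C /\ (excess b C = 0 <-> vertex_cover G K (~: C))) ->
  exists2 x, polytope G b x & K = gr1 x.
Proof.
move=> bK.
pose strict C := `[< vertex_cover G K C /\ ~ vertex_cover G K (~: C) >].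
(* The least excess of a strict cover; the default 1 keeps it positive when there is none. *)
pose gap : R := \big[Num.min/1]_(C | strict C) excess b C.
have gap0 : 0 < gap.
  apply: lt_bigmin => // C /asboolP[KC KnC]; have [b0 bE] := bK C KC.
  by rewrite lt_neqAle b0 andbT; apply/eqP => /esym/bE.
have gapC C : strict C -> gap <= excess b C by exact: bigmin_le_cond.
(* An edge adds at most 2 to [excess d C], so this [eps] lowers an excess by at most [gap]; the
   successor keeps the denominator positive for empty [K]. *)
pose eps := gap / (2 * #|K|.+1%:R).
have eps0 : 0 < eps by rewrite divr_gt0 // mulr_gt0.
have epsK : eps * (2 * #|K|%:R) <= gap.
  rewrite /eps mulrAC ler_pdivrMr ?mulr_gt0 // ler_pM2l //.
  by rewrite ler_pM2l // ler_nat.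
pose k : {ffun E -> R} := [ffun e => (e \in K)%:R].
pose d : {ffun V -> R} := [ffun v => \sum_(e in incident_edges G v) k e].
have dE C : excess d C = \sum_(e in K) \sum_(v in ends G e) cover_sign C v.
  rewrite /excess (@double_count _ _ _ G d k) => [|v]; last by rewrite ffunE.
  rewrite [RHS]big_mkcond; apply: eq_bigr => e _.
  by rewrite ffunE; case: (e \in K); rewrite ?mul1r ?mul0r.
pose b' : {ffun V -> R} := [ffun v => b v - eps * d v].
have b'E C : excess b' C = excess b C - eps * excess d C.
  rewrite mulr_sumr -sumrB; apply: eq_bigr => v _.
  by rewrite [b' v]ffunE; ring.
have [|x [x0 xb] xK] := @cover_feasible K b'.
  move=> C KC; have [b0 bE] := bK C KC; rewrite b'E.
  (* If the complement covers too, every edge of [K] has exactly one endpoint in [C], so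
     [excess d C] vanishes; otherwise [gap] absorbs the perturbation. *)
  case: (pselect (vertex_cover G K (~: C))) => KnC.
    rewrite (bE.2 KnC) dE big1 ?mulr0 ?subr0 // => e eK.
    have [u [w [uA wA euw]]] := GA e; rewrite (sum_ends _ uA wA euw).
    move/vertex_coverE: KC => /(_ e u w eK uA wA euw).
    move/vertex_coverE: KnC => /(_ e u w eK uA wA euw).
    rewrite /cover_sign !finset.inE.
    by case: (u \in C); case: (w \in C) => // _ _; rewrite ?subrr ?addNr.
  have := gapC C (asboolT (conj KC KnC)).
  suff : eps * excess d C <= eps * (2 * #|K|%:R) by lra.
  rewrite ler_pM2l // dE mulr_natr -sumr_const; apply: ler_sum => e _.
  have [u [w [uA wA euw]]] := GA e; rewrite (sum_ends _ uA wA euw) /cover_sign.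
  by case: (u \in C); case: (w \in C); lra.
exists [ffun e => x e + eps * k e].
  split=> [e|v].
    by rewrite ffunE addr_ge0 // mulr_ge0 ?(ltW eps0) // ffunE ler0n.
  under eq_bigr do rewrite ffunE.
  by rewrite big_split /= xb -mulr_sumr !ffunE subrK.
apply/setP => e; rewrite mem_gr1 !ffunE; case: (boolP (e \in K)) => eK.
  by rewrite mulr1 ltr_wpDl.
by rewrite mulr0 addr0 xK // ltxx.
Qed.

(** With [y] equal to 1, 0, -1 on [V1], [V2], [V3], the endpoint sum of each edge of [gr1 x] is
    nonnegative, and zero exactly off the edges between [V1] and [V1 :|: V2]. The difference of the
    two sides is the sum of these weighted by [x], which is positive on [gr1 x]. *)
Lemma graph_separation b (x : {ffun E -> R}) (V1 V2 V3 : {set V}) :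
  polytope G b x ->
  [disjoint V1 & V2] -> [disjoint V1 & V3] -> [disjoint V2 & V3] ->
  finset.setT = V1 :|: V2 :|: V3 ->
  edges_between G (gr1 x) (V2 :|: V3) V3 = finset.set0 ->
  \sum_(v in V1) b v >= \sum_(v in V3) b v /\
  (\sum_(v in V1) b v = \sum_(v in V3) b v <->
   edges_between G (gr1 x) V1 (V1 :|: V2) = finset.set0).
Proof.
move=> Px /pred0P d12 /pred0P d13 /pred0P d23 VE /edges_between_eq0 H3.
pose y v : R := (v \in V1)%:R - (v \in V3)%:R.
have bE : \sum_(v in V1) b v - \sum_(v in V3) b v =
          \sum_e x e * \sum_(v in ends G e) y v.
  rewrite -(double_count _ Px.2) big_mkcond [X in _ - X]big_mkcond -sumrB.
  apply: eq_bigr => v _; rewrite /y mulrBl.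
  by case: (v \in V1); case: (v \in V3); rewrite ?mul1r ?mul0r.
have cases v : ((v \in V1, v \in V2), v \in V3) \in
    [:: (true, false, false); (false, true, false); (false, false, true)].
  have := d12 v; have := d13 v; have := d23 v; have := finset.in_setT v.
  rewrite VE !finset.inE /=.
  by case: (v \in V1); case: (v \in V2); case: (v \in V3).
have yE e u w : e \in gr1 x -> u \in A -> w \notin A -> ends G e = [set u; w]%SET ->
    0 <= y u + y w /\
    (y u + y w == 0) = ~~ ((u \in V1) && (w \in V1 :|: V2) ||
                           (w \in V1) && (u \in V1 :|: V2)).
  move=> ex uA wA euw; have := H3 e u w ex uA wA euw.
  move: (cases u) (cases w); rewrite /y !finset.inE.
  case: (u \in V1); case: (u \in V2); case: (u \in V3) => // _;
    case: (w \in V1); case: (w \in V2); case: (w \in V3) => //= _ _;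
    clear VE euw; split; (lra || (apply/eqP; lra) || (apply/negbTE/eqP; lra)).
have term0 e : 0 <= x e * \sum_(v in ends G e) y v.
  case: (boolP (e \in gr1 x)) => ex; last by rewrite (gr1_eq0 Px ex) mul0r.
  have [u [w [uA wA euw]]] := GA e; rewrite (sum_ends _ uA wA euw).
  by rewrite mulr_ge0 ?Px.1 ?(yE e u w ex uA wA euw).1.
split; first by rewrite -subr_ge0 bE sumr_ge0.
split=> [b0|/edges_between_eq0 H1].
  apply/edges_between_eq0 => e u w ex uA wA euw.
  have {}b0 : \sum_e x e * \sum_(v in ends G e) y v = 0 by rewrite -bE b0 subrr.
  move/eqP: (psumr_eq0P (fun e _ => term0 e) b0 (i := e) isT).
  rewrite (sum_ends _ uA wA euw) -(yE e u w ex uA wA euw).2 mulf_eq0 => /orP[|//].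
  by rewrite gt_eqF // -mem_gr1.
apply/eqP; rewrite -subr_eq0 bE; apply/eqP/big1 => e _.
case: (boolP (e \in gr1 x)) => ex; last by rewrite (gr1_eq0 Px ex) mul0r.
have [u [w [uA wA euw]]] := GA e; rewrite (sum_ends _ uA wA euw).
have := H1 e u w ex uA wA euw.
by rewrite -(yE e u w ex uA wA euw).2 => /eqP ->; rewrite mulr0.
Qed.

End Covers.

(** * The cycle of implications *)

Theorem corollary36 (R : realType) (V E : finType) (G : multigraph V E)
    (b : {ffun V -> R}) (H : {set E})
    (V_nonempty : (0 < #|V|)%N) (G_bipartite : bipartite G)
    (b_neq0 : b <> 0) (b_ge0 : forall v, 0 <= b v) :
  [<-> (* (i) *)
       graphs_of_polytope G b H;
       (* (ii) *)
       exists2 X : set {ffun E -> R}, (X `<=` polytope G b)%classic & H = gr X;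
       (* (iii) *)
       (exists2 x, polytope G b x & H = gr1 x) \/ H = finset.set0;
       (* (iv) *)
       exists2 F, face (polytope G b) F & H = gr F;
       (* (v) *)
       exists2 S : {set {set E}},
         S \subset vertex_graphs G b & H = \bigcup_(K in S) K;
       (* (vi) *)
       H = \bigcup_(K in vertex_graphs G b | K \subset H) K;
       (* (vii) *)
       H = finset.set0 \/
       forall V1 V2 V3 : {set V},
         [disjoint V1 & V2] -> [disjoint V1 & V3] -> [disjoint V2 & V3] ->
         finset.setT = V1 :|: V2 :|: V3 ->
         edges_between G H (V2 :|: V3) V3 = finset.set0 ->
         \sum_(v in V1) b v >= \sum_(v in V3) b v /\
         (\sum_(v in V1) b v = \sum_(v in V3) b v <->
          edges_between G H V1 (V1 :|: V2) = finset.set0);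
       (* (viii) *)
       H = finset.set0 \/
       forall C : {set V},
         vertex_cover G H C ->
         \sum_(v in C) b v >= \sum_(v in ~: C) b v /\
         (\sum_(v in C) b v = \sum_(v in ~: C) b v <->
          vertex_cover G H (~: C))].
Proof.
have [A GA] := G_bipartite.
have gr0 : gr (classical_sets.set0 : set {ffun E -> R}) = finset.set0.
  by apply/setP => e; rewrite !finset.inE; apply/asboolP => -[].
have vertexP x : vertex (polytope G b) x -> polytope G b x.
  case=> c [d [_ xE]].
  by have : [set x]%classic x by []; rewrite xE => -[].
tfae.
- by case=> X XP <-; exists X.
- case=> X XP ->; have [X0|X0] := eqVneq (gr X) finset.set0; first by right.
  by left; apply: gr_average X0.
- case=> [[x Px HE]|->]; last first.
    (* The edgeless graph comes from the empty face, cut out by [0 <= 1]. *)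
    exists classical_sets.set0 => //; exists 0, 1; split=> [x _|].
      by rewrite big1 // => e _; rewrite ffunE mul0r.
    apply/seteqP; split=> x //= -[_]; rewrite big1 => [/esym/eqP|e _].
      by rewrite oner_eq0.
    by rewrite ffunE mul0r.
  exists [set y | polytope G b y /\ gr1 y \subset H]%classic.
    exact: support_face.
  apply/eqP; rewrite finset.eqEsubset {1}HE gr1_sub_gr /=; last by rewrite HE.
  apply/fintype.subsetP => e; rewrite inE => /asboolP[y [_ /fintype.subsetP yH] ye].
  by apply: yH; rewrite mem_gr1.
- case=> F [c [d [_ FE]]] HE.
  (* All vertex graphs inside [H] suffice: an edge of [H] is positive at some point of [F], and a
     vertex supported within that point is positive there too. *)
  exists [set K in vertex_graphs G b | K \subset H]%SET.
    by apply/fintype.subsetP => K; rewrite finset.inE => /andP[].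
  apply/setP => e; apply/idP/finset.bigcupP => [|[K]]; last first.
    by rewrite finset.inE => /andP[_ /fintype.subsetP]; apply.
  rewrite HE inE => /asboolP[x Fx xe].
  have Px : polytope G b x by move: Fx; rewrite FE => -[].
  have [|y vy /andP[yx ye]] := vertex_through_edge Px (e := e).
    by rewrite mem_gr1.
  exists (gr1 y) => //; rewrite finset.inE (fintype.subset_trans yx) ?gr1_sub_gr //.
  by rewrite andbT inE; apply/asboolP; exists y.
- case=> S /fintype.subsetP SV HE; apply/setP => e; apply/idP/finset.bigcupP.
    rewrite {1}HE => /finset.bigcupP[K KS eK]; exists K => //.
    by rewrite SV //= HE finset.bigcup_sup.
  by case=> K /andP[_ /fintype.subsetP]; apply.
- move=> HE; have [H0|H0] := eqVneq H finset.set0; [by left|right].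
  pose X : set {ffun E -> R} :=
    [set x | vertex (polytope G b) x /\ gr1 x \subset H]%classic.
  have XE : gr X = H.
    apply/setP => e; rewrite inE; apply/asboolP/idP.
      by case=> x [_ /fintype.subsetP xH] xe; apply: xH; rewrite mem_gr1.
    rewrite HE => /finset.bigcupP[K /andP[]]; rewrite inE => /asboolP[x vx ->] xH xe.
    by exists x; rewrite -?mem_gr1.
  have [||x Px] := @gr_average _ _ _ G b X; [by move=> x [/vertexP]|by rewrite XE|].
  by rewrite XE => -> V1 V2 V3; apply: (graph_separation GA).
- case=> [|HV]; [by left|right] => C HC.
  (* For this partition, the two emptiness conditions say that [C] and its complement, respectively,
     are covers. *)
  have [|||||CE CeqE] := HV C finset.set0 (~: C).
  + by rewrite finset.disjoints_subset finset.setC0 finset.subsetT.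
  + by rewrite finset.disjoints_subset finset.setCK.
  + by rewrite finset.disjoints_subset finset.sub0set.
  + by rewrite finset.setU0 finset.setUCr.
  + rewrite finset.set0U; apply/(edges_between_eq0 GA) => e u w eH uA wA euw.
    have := (vertex_coverE GA _ _).1 HC e u w eH uA wA euw.
    by rewrite !finset.inE; case: (u \in C); case: (w \in C).
  split=> //; rewrite CeqE finset.setU0 (edges_between_eq0 GA) (vertex_coverE GA).
  by split=> h e u w eH uA wA euw; have := h e u w eH uA wA euw;
    rewrite !finset.inE; case: (u \in C); case: (w \in C).
- case=> [->|HC]; first by exists classical_sets.set0.
  have [|x Px ->] := @cover_graph R _ _ _ _ GA H b.
    move=> C /HC[CE CeqE]; rewrite excessE subr_ge0; split=> //.
    rewrite -CeqE; split=> [/eqP|->]; last by rewrite subrr.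
    by rewrite subr_eq0 => /eqP.
  by exists [set x]%classic => // y ->.
Qed.
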